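(* Let $f:[0,1]\to\mathbb{R}$ be continuously differentiable with $f(y)>0$ for all $y\in[0,1]$ and $f(0)=f(1)$. Then for any $\alpha,\beta\in\mathbb{R}$, $$\big\langle\, f^\alpha f'\cdot [\![\,f^\beta f'\,]\!]\,\big\rangle=0 .$$
   Context: For a continuous function $g:[0,1]\to\mathbb{R}$ define its average $\langle g\rangle:=\int_0^1 g(y)\,dy$, its fluctuating part $\{g\}(y):=g(y)-\langle g\rangle$, and the function $$[\![g]\!](y):=\int_0^y\{g\}(\xi)\,d\xi-\int_0^1\int_0^\tau\{g\}(\xi)\,d\xi\,d\tau .$$ Here $f^\alpha$ denotes the pointwise real power $y\mapsto f(y)^\alpha$. *)

(* Defs.v *)
From Stdlib Require Import Reals.
From Coquelicot Require Import Coquelicot.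
Open Scope R_scope.

(* Functions on [0,1] are represented by total functions R -> R of which only
   the values on [0,1] are ever used. *)
Definition unit_interval (y : R) : Prop := 0 <= y <= 1.

(* [D_in] and [continue_in] are relative to [0,1], hence one-sided at the
   endpoints. *)
Definition continuously_differentiable_with (f f' : R -> R) : Prop :=
  forall y : R, unit_interval y ->
    D_in f f' unit_interval y /\ continue_in f' unit_interval y.

Definition average (g : R -> R) : R := RInt g 0 1.

Definition fluctuation (g : R -> R) (y : R) : R := g y - average g.

Definition double_bracket (g : R -> R) (y : R) : R :=
  RInt (fluctuation g) 0 y
  - RInt (fun tau => RInt (fluctuation g) 0 tau) 0 1.

(* Main.v *)
(** Both factors are of the form [g (f y) * f' y], up to a constant shift of the
    bracket.  Substituting [s = f y] turns the bracket of [f^beta f'] into a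
    function [P (f y) - k]; the mean of [f^beta f'] vanishes because
    [f 0 = f 1].  The integrand is then [g (f y) * f' y] with
    [g s = s^alpha (P s - k)], and its integral is that of [g] from [f 0] to
    [f 1], an interval of length zero. *)
Require Import Defs.
From Stdlib Require Import Reals Lra.
From Coquelicot Require Import Coquelicot.
Open Scope R_scope.

(* Composing with [clamp] turns the one-sided regularity hypotheses on [0,1]
   into the two-sided ones required by Coquelicot. *)
Definition clamp (x : R) : R := Rmax 0 (Rmin x 1).

Lemma clamp_unit x : unit_interval (clamp x).
Proof.
  unfold clamp, unit_interval, Rmax, Rmin.
  repeat destruct Rle_dec; lra.
Qed.

Lemma clamp_id x : unit_interval x -> clamp x = x.
Proof.
  unfold clamp, unit_interval, Rmax, Rmin; intros Hx.
  repeat destruct Rle_dec; lra.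
Qed.

Lemma clamp_lipschitz x y : Rabs (clamp x - clamp y) <= Rabs (x - y).
Proof.
  unfold clamp, Rmax, Rmin.
  repeat destruct Rle_dec; unfold Rabs; repeat destruct Rcase_abs; lra.
Qed.

(** [clamp] is 1-Lipschitz with values in [0,1], so the radius that the relative continuity gives at
    [clamp x] also serves at [x]. *)
Lemma continuous_clamp (h : R -> R) :
  (forall y, unit_interval y -> continue_in h unit_interval y) ->
  forall x, continuous (fun t => h (clamp t)) x.
Proof.
  intros Hh x.
  apply continuity_pt_filterlim.
  intros eps Heps.
  destruct (Hh (clamp x) (clamp_unit x) eps Heps) as [d [Hd H]].
  exists d; split; [exact Hd|].
  intros t [_ Ht].
  (* [continue_in] says nothing at the base point itself, and [clamp] can send [t] there even when
     [t] differs from [x]. *)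
  destruct (Req_dec (clamp x) (clamp t)) as [E|E].
  - simpl; unfold Rdist; rewrite E, Rminus_diag, Rabs_R0; exact Heps.
  - apply H; split.
    + split; [apply clamp_unit | exact E].
    + simpl in *; unfold Rdist in *.
      generalize (clamp_lipschitz t x); lra.
Qed.

Lemma is_derive_clamp (f f' : R -> R) x :
  0 < x < 1 -> D_in f f' unit_interval x ->
  is_derive (fun t => f (clamp t)) x (f' x).
Proof.
  intros Hx HD.
  apply is_derive_Reals.
  intros eps Heps.
  destruct (HD eps Heps) as [d [Hd H]].
  (* Besides [d], the radius is bounded by the distance to both endpoints, which keeps [x + h] where
     [clamp] is the identity. *)
  assert (Hm : 0 < Rmin d (Rmin x (1 - x))) by (repeat apply Rmin_pos; lra).
  exists (mkposreal _ Hm); simpl.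
  intros h Hh0 Hh.
  generalize (Rmin_l d (Rmin x (1 - x))) (Rmin_r d (Rmin x (1 - x)))
    (Rmin_l x (1 - x)) (Rmin_r x (1 - x)); intros.
  assert (Hu : unit_interval (x + h)).
  { unfold unit_interval; destruct (Rabs_def2 _ _ Hh); lra. }
  rewrite !clamp_id by (unfold unit_interval in *; lra).
  specialize (H (x + h)); simpl in H; unfold Rdist in H.
  replace (x + h - x) with h in H by ring.
  apply H; split; [split; [exact Hu | lra] | lra].
Qed.

(** The derivative is asked for only inside the interval because [f (clamp t)] may have corners at 0
    and 1. The integral of [w] minus [W] is continuous with zero derivative inside, so the mean
    value theorem gives it equal values at [a] and [b]. *)
Lemma RInt_derive_interior (W w : R -> R) (a b : R) :
  a <= b ->
  (forall x, continuous W x) -> (forall x, continuous w x) ->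
  (forall x, a < x < b -> is_derive W x (w x)) ->
  RInt w a b = W b - W a.
Proof.
  intros Hab HW Hw HD.
  assert (HI : forall x, is_derive (fun t => RInt w a t) x (w x)).
  { intros x; apply is_derive_RInt with a; [|apply Hw].
    apply filter_forall; intros y.
    apply (@RInt_correct R_CompleteNormedModule), ex_RInt_continuous.
    intros; apply Hw. }
  destruct (MVT_gen (fun t => RInt w a t - W t) a b (fun _ => 0))
    as [c [_ Hc]].
  - rewrite Rmin_left, Rmax_right by exact Hab.
    intros x Hx.
    replace 0 with (w x - w x) by ring.
    apply (@is_derive_minus R_AbsRing R_NormedModule); [apply HI | now apply HD].
  - intros x _.
    apply continuity_pt_minus; apply continuity_pt_filterlim; [|apply HW].
    apply (@ex_derive_continuous R_AbsRing R_NormedModule).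
    now exists (w x).
  - rewrite RInt_point in Hc.
    change (@zero R_CompleteNormedModule) with 0 in Hc; lra.
Qed.

Lemma is_derive_RInt_pos (g : R -> R) (a x : R) :
  (forall s, 0 < s -> continuous g s) -> 0 < a -> 0 < x ->
  is_derive (fun t => RInt g a t) x (g x).
Proof.
  intros Hg Ha Hx.
  apply is_derive_RInt with a; [|now apply Hg].
  (* The ball of radius [x] around [x] consists of positive reals, so the segment from [a] to any
     [y] in it stays where [g] is continuous. *)
  exists (mkposreal x Hx); intros y Hy.
  apply (@RInt_correct R_CompleteNormedModule), ex_RInt_continuous.
  intros z [Hz _]; apply Hg.
  apply Rlt_le_trans with (2 := Hz).
  apply Rmin_pos; [exact Ha|].
  change (Rabs (y - x) < x) in Hy.
  destruct (Rabs_def2 _ _ Hy); lra.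
Qed.

(** With G the integral of [g] from [f 0], the chain rule makes G composed with [f] a primitive of
    the integrand; positivity of [f] keeps its values where G is differentiable. *)
Lemma RInt_substitution (f f' g : R -> R) (y : R) :
  continuously_differentiable_with f f' ->
  (forall x, unit_interval x -> 0 < f x) ->
  (forall s, 0 < s -> continuous g s) ->
  unit_interval y ->
  RInt (fun x => g (f x) * f' x) 0 y = RInt g (f 0) (f y).
Proof.
  intros HC Hpos Hg Hy.
  assert (U0 : unit_interval 0) by (unfold unit_interval; lra).
  assert (Hf : forall x, continuous (fun t => f (clamp t)) x).
  { apply continuous_clamp; intros x Hx.
    exact (cont_deriv _ _ _ _ (proj1 (HC x Hx))). }
  assert (Hf' : forall x, continuous (fun t => f' (clamp t)) x).
  { apply continuous_clamp; intros x Hx; exact (proj2 (HC x Hx)). }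
  assert (HG : forall x, unit_interval x ->
    is_derive (fun s => RInt g (f 0) s) (f x) (g (f x))).
  { intros x Hx; apply is_derive_RInt_pos; auto. }
  (* The clamped integrand agrees with the original between 0 and [y] and is continuous on the whole
     line. *)
  rewrite (RInt_ext _ (fun x => g (f (clamp x)) * f' (clamp x))).
  2:{ rewrite Rmin_left, Rmax_right by apply Hy.
      intros x Hx; rewrite clamp_id; [reflexivity|].
      unfold unit_interval in *; lra. }
  rewrite (RInt_derive_interior (fun t => RInt g (f 0) (f (clamp t)))).
  - rewrite !clamp_id by assumption.
    rewrite RInt_point; apply Rminus_0_r.
  - apply Hy.
  - intros x.
    apply (continuous_comp (fun t => f (clamp t)) (fun s => RInt g (f 0) s)).
    + apply Hf.
    + apply (@ex_derive_continuous R_AbsRing R_NormedModule).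
      eexists; apply HG, clamp_unit.
  - intros x.
    apply (continuous_mult (fun t => g (f (clamp t))) (fun t => f' (clamp t))).
    + apply (continuous_comp (fun t => f (clamp t)) g); [apply Hf|].
      apply Hg, Hpos, clamp_unit.
    + apply Hf'.
  - intros x Hx.
    assert (Ux : unit_interval x) by (unfold unit_interval in *; lra).
    rewrite (clamp_id x Ux), Rmult_comm.
    apply (is_derive_comp (fun s => RInt g (f 0) s) (fun t => f (clamp t))).
    + rewrite (clamp_id x Ux); now apply HG.
    + apply is_derive_clamp; [unfold unit_interval in *; lra | apply HC, Ux].
Qed.

Lemma continuous_Rpower (a s : R) : 0 < s -> continuous (fun t => Rpower t a) s.
Proof.
  intros Hs.
  apply (@ex_derive_continuous R_AbsRing R_NormedModule).
  exists (a * Rpower s (a - 1)).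
  apply is_derive_Reals, derivable_pt_lim_power, Hs.
Qed.

Theorem corollary1 (f f' : R -> R)
  (f_C1 : continuously_differentiable_with f f')
  (f_pos : forall y : R, unit_interval y -> 0 < f y)
  (f_periodic : f 0 = f 1)
  (alpha beta : R) :
  average (fun y => Rpower (f y) alpha * f' y *
                    double_bracket (fun x => Rpower (f x) beta * f' x) y) = 0.
Proof.
  assert (U0 : unit_interval 0) by (unfold unit_interval; lra).
  assert (U1 : unit_interval 1) by (unfold unit_interval; lra).
  set (P := fun s : R => RInt (fun t => Rpower t beta) (f 0) s).
  assert (Hsub : forall y, unit_interval y ->
    RInt (fun x => Rpower (f x) beta * f' x) 0 y = P (f y)).
  { intros y Hy.
    apply (RInt_substitution f f' (fun t => Rpower t beta)); auto.
    intros; now apply continuous_Rpower. }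
  set (h := fun x => Rpower (f x) beta * f' x) in *.
  assert (Hmean : average h = 0).
  { unfold average; rewrite Hsub by exact U1.
    unfold P; rewrite <- f_periodic; exact (RInt_point (V := R_CompleteNormedModule) _ _). }
  set (k := RInt (fun tau => RInt (fluctuation h) 0 tau) 0 1).
  assert (Hbr : forall y, unit_interval y -> double_bracket h y = P (f y) - k).
  { intros y Hy; unfold double_bracket; fold k.
    (* Since [h] has mean zero, it is its own fluctuation, and the first term of the bracket is the
       integral of [h]. *)
    rewrite <- (Hsub y Hy); f_equal.
    apply RInt_ext; intros x _.
    unfold fluctuation; rewrite Hmean; apply Rminus_0_r. }
  set (g := fun s => Rpower s alpha * (P s - k)).
  assert (Hg : forall s, 0 < s -> continuous g s).
  { intros s Hs.
    apply (continuous_mult (fun t => Rpower t alpha) (fun t => P t - k)).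
    - now apply continuous_Rpower.
    - apply (@continuous_minus _ R_AbsRing R_NormedModule);
        [|apply continuous_const].
      apply (@ex_derive_continuous R_AbsRing R_NormedModule).
      eexists; apply is_derive_RInt_pos; auto.
      intros; now apply continuous_Rpower. }
  unfold average.
  rewrite (RInt_ext _ (fun y => g (f y) * f' y)).
  - rewrite RInt_substitution by assumption.
    rewrite <- f_periodic; exact (RInt_point (V := R_CompleteNormedModule) _ _).
  - rewrite Rmin_left, Rmax_right by lra.
    intros y Hy; rewrite Hbr by (unfold unit_interval; lra).
    unfold g.
    change (Rpower (f y) alpha * f' y * (P (f y) - k)
      = Rpower (f y) alpha * (P (f y) - k) * f' y :> R); ring.
Qed.
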